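(* Suppose $n$ is even and there exist distinct integers $a_1,a_2,a_3\in\mathbb{Z}_n$ such that $S=\{sr^{a_1},\,sr^{a_2},\,sr^{a_3},\,r^{n/2}\}$. Let $\Gamma=\mathrm{Cay}(D_{2n},S)$. For $j=1,2,3$, define $M_{a_j}=\bigl\{\{r^i,\,sr^{a_j-i}\}: i\in\mathbb{Z}_n\bigr\}$, and define $N_{R_n}=\bigl\{\{r^i,\,r^{i+n/2}\}: i\in\mathbb{Z}_n\bigr\}$ and $N_{F_n}=\bigl\{\{sr^i,\,sr^{i+n/2}\}: i\in\mathbb{Z}_n\bigr\}$. Then $$E(\Gamma)=N_{R_n}\cup N_{F_n}\cup M_{a_1}\cup M_{a_2}\cup M_{a_3}.$$
   Context: $D_{2n}=\langle r,s\mid r^n=e,\ s^2=e,\ srs=r^{-1}\rangle$ is the dihedral group of order $2n$; $R_n=\{r^i:i\in\mathbb{Z}_n\}$ is the set of all rotations and $F_n=\{sr^i:i\in\mathbb{Z}_n\}$ is the set of all reflections, so $D_{2n}=R_n\cup F_n$; $\mathbb{Z}_n$ is the cyclic group of order $n$, and indices of rotations and reflections are taken modulo $n$. For a group $G$ and an inverse-closed subset $S\subseteq G\setminus\{e\}$ (that is, $S=S^{-1}$), the undirected Cayley graph $\mathrm{Cay}(G,S)$ is the graph with vertex set $G$ in which vertices $u$ and $v$ are adjacent if and only if $uv^{-1}\in S$. $E(\Gamma)$ denotes the edge set of $\Gamma$.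
   Formalization: Adjacency in Cay(G,S) is taken as u^{-1}v ∈ S instead of uv^{-1} ∈ S; with the latter the claim fails, e.g. n=4, a=(0,1,2): {r,s} lies in M_1 but rs^{-1}=sr^3 is not in S. *)

(* Defs.v *)
From mathcomp Require Import all_boot all_algebra all_fingroup all_solvable.

Set Implicit Arguments.
Unset Strict Implicit.
Unset Printing Implicit Defensive.

Import GRing.Theory.
Local Open Scope group_scope.

(* G is D_2n = < r, s | r^n = s^2 = e, srs = r^-1 >.  The presentation pins G
   down up to isomorphism only, so the last four conditions are needed to say
   that r and s are the generators it names. *)
Definition dihedral_on (gT : finGroupType) (n : nat) (G : {group gT})
    (r s : gT) : Prop :=
  [/\ G \isog Grp (x : y : x ^+ n, y ^+ 2, y * x * y = x^-1),
      <<[set r; s]>> = G,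
      r ^+ n = 1, s ^+ 2 = 1 & s * r * s = r^-1].

(* Adjacency is u^-1 v \in S, i.e. v \in u S.  With the other convention
   u v^-1 \in S (which gives an isomorphic graph, via inversion) the neighbours
   of r^i through the reflection s r^a would be s r^(a + i) instead of
   s r^(a - i).  For S inverse-closed, the relation is symmetric. *)
Definition cayley_adj (gT : finGroupType) (S : {set gT}) : rel gT :=
  [rel u v | u^-1 * v \in S].

Definition cayley_edges (gT : finGroupType) (G S : {set gT}) :
    {set {set gT}} :=
  [set [set u; v] | u in G, v in G & cayley_adj S u v].

(* Indices i : 'Z_n coerce to nat in exponents; a - i is subtraction in 'Z_n,
   which is the ring of integers mod n as soon as 1 < n. *)
Section EdgeSets.
Variables (gT : finGroupType) (n : nat) (r s : gT).

Definition M (a : 'Z_n) : {set {set gT}} :=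
  [set [set r ^+ i; s * r ^+ (a - i)%R] | i : 'Z_n].

Definition N_R : {set {set gT}} :=
  [set [set r ^+ i; r ^+ (i + n %/ 2)] | i : 'Z_n].

Definition N_F : {set {set gT}} :=
  [set [set s * r ^+ i; s * r ^+ (i + n %/ 2)] | i : 'Z_n].

End EdgeSets.

(* Main.v *)
Require Import Defs.
From mathcomp Require Import all_boot all_algebra all_fingroup all_solvable.

(** The edges of a Cayley graph are the pairs [{u, u * c}] with [u] in the group
    and [c] in the connection set ([cayley_edgesE]), and every element of the
    dihedral group is a rotation [r ^+ i] or a reflection [s * r ^+ i]
    ([dihedral_rot_or_refl]).  So the edges come in four kinds, according to
    the kinds of [u] and [c].  Multiplying by [c = r ^+ (n %/ 2)] keeps the
    kind of [u], and yields the edges of [N_R] and [N_F].  Multiplying by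
    [c = s * r ^+ a] exchanges the two kinds:
      [r ^+ i * (s * r ^+ a) = s * r ^+ (a - i)], and
      [s * r ^+ i * (s * r ^+ a) = r ^+ (a - i)].
    The first product gives the edges of [M a] seen from their rotation end; the
    second gives the same edges seen from their reflection end, because
    [i |-> a - i] is an involution of the indices. *)

Set Implicit Arguments.
Unset Strict Implicit.
Unset Printing Implicit Defensive.

Local Open Scope group_scope.

(** * Edges of a Cayley graph *)

(** The substitution [c = u^-1 * v] trades the adjacency test for a free choice
    of [c] in [S], so that edges can be enumerated from one end. *)
Lemma cayley_edgesE (gT : finGroupType) (G : {group gT}) (S : {set gT}) :
  S \subset G -> cayley_edges G S = [set [set u; u * c] | u in G, c in S].
Proof.
move=> sSG; apply/setP => e; apply/imset2P/imset2P => [] [u v uG].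
  rewrite inE => /andP[_ uv] ->.
  by exists u (u^-1 * v) => //; rewrite mulKVg.
move=> vS ->; exists u (u * v) => //.
by rewrite inE /cayley_adj /= mulKg vS groupM // (subsetP sSG).
Qed.

(** * Exponents modulo n *)

Section ZnExponents.
Variables (gT : finGroupType) (n : nat) (r : gT).
Hypotheses (n_gt1 : 1 < n) (rn : r ^+ n = 1).

Lemma expg_inZp (k : nat) : r ^+ (inZp k : 'Z_n) = r ^+ k.
Proof. by rewrite /= Zp_cast // expg_mod. Qed.

Lemma expg_ZnB (a i : 'Z_n) : r ^+ (a - i)%R = r ^+ a * r ^- i.
Proof.
apply: (canRL (mulgK _)); rewrite -expgD -[in RHS](GRing.subrK i a).
exact/esym/expg_inZp.
Qed.

End ZnExponents.

(** * Rotations and reflections *)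

Section Dihedral.
Variables (gT : finGroupType) (n : nat) (r s : gT).
Hypotheses (n_gt1 : 1 < n) (rn : r ^+ n = 1).
Hypotheses (s2 : s ^+ 2 = 1) (srs : s * r * s = r^-1).

Let ss : s * s = 1. Proof. exact: s2. Qed.

Let sV : s^-1 = s. Proof. by apply/eqP; rewrite eq_invg_mul ss. Qed.

Let rJs : r ^ s = r^-1. Proof. by rewrite conjgE sV mulgA srs. Qed.

Lemma rot_mul_refl (a i : 'Z_n) :
  r ^+ i * (s * r ^+ a) = s * r ^+ (a - i)%R.
Proof.
rewrite mulgA (conjgC _ s) conjXg rJs expg_ZnB // -mulgA expgVn; congr (s * _).
exact/commute_sym/commuteV/commuteX2.
Qed.

Lemma refl_mul_refl (a i : 'Z_n) :
  s * r ^+ i * (s * r ^+ a) = r ^+ (a - i)%R.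
Proof. by rewrite -mulgA rot_mul_refl mulgA ss mul1g. Qed.

(** The relation [srs = r^-1] makes [s] normalise [<[r]>], so the generated
    group is the product [<[s]> * <[r]>], where [<[s]>] is [{1, s}]. *)
Lemma dihedral_rot_or_refl (x : gT) : x \in <<[set r; s]>> ->
  (exists i : 'Z_n, x = r ^+ i) \/ (exists i : 'Z_n, x = s * r ^+ i).
Proof.
have nrs : <[s]> \subset 'N(<[r]>).
  by rewrite cycle_subG; apply/normP; rewrite -cycleJ rJs cycleV.
rewrite setUC -[<<_>>]/([set s] <*> [set r]) -joing_idl -joing_idr.
rewrite norm_joinEl //.
case/mulsgP=> _ _ /cycleP[j ->] /cycleP[k ->] ->.
rewrite -(expg_mod j s2) modn2 -(expg_inZp n_gt1 rn k).
by case: (odd j); [right; rewrite expg1 | left; rewrite expg0 mul1g]; eexists.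
Qed.

End Dihedral.

(** * The edges of the dihedral Cayley graph *)

Theorem proposition5p3 (gT : finGroupType) (n : nat) (G : {group gT})
    (r s : gT) (S : {set gT}) (a1 a2 a3 : 'Z_n) :
  1 < n -> ~~ odd n ->
  dihedral_on n G r s ->
  a1 != a2 -> a1 != a3 -> a2 != a3 ->
  S = [set s * r ^+ a1; s * r ^+ a2; s * r ^+ a3; r ^+ (n %/ 2)] ->
  cayley_edges G S =
    N_R n r :|: N_F n r s :|: M r s a1 :|: M r s a2 :|: M r s a3.
Proof.
move=> n_gt1 _ [_ defG rn s2 srs] _ _ _ defS.
have rG : r \in G by rewrite -defG mem_gen // !inE eqxx.
have sG : s \in G by rewrite -defG mem_gen // !inE eqxx orbT.
have sSG : S \subset G.
  apply/subsetP => c; rewrite defS !inE.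
  by case/orP=> [/orP[/orP[]|]|] /eqP ->; rewrite ?groupM ?groupX.
rewrite cayley_edgesE //; apply/setP => e; rewrite !inE.
have edgeM (a : 'Z_n) (u : gT) : u \in G ->
    [set u; u * (s * r ^+ a)] \in M r s a.
  rewrite -defG => /(dihedral_rot_or_refl n_gt1 rn s2 srs)[] [i ->].
    by rewrite rot_mul_refl //; apply: imset_f.
  (* Seen from the reflection of index i, the rotation end has index a - i. *)
  rewrite refl_mul_refl // setUC; apply/imsetP; exists (a - i)%R => //.
  by rewrite GRing.subKr.
apply/imset2P/idP => [[u c uG] | ].
  rewrite defS !inE => /orP[/orP[/orP[]|]|] /eqP -> ->;
    rewrite ?edgeM ?orbT //.
  move: uG; rewrite -defG.
  case/(dihedral_rot_or_refl n_gt1 rn s2 srs)=> [] [i ->].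
    by rewrite -expgD (imset_f (fun i : 'Z_n => [set r ^+ i; _])).
  rewrite -mulgA -expgD.
  by rewrite (imset_f (fun i : 'Z_n => [set s * r ^+ i; _])) ?orbT.
case/orP=> [/orP[/orP[/orP[]|]|]|] /imsetP[i _ ->].
- exists (r ^+ i) (r ^+ (n %/ 2)); rewrite ?groupX ?expgD //.
  by rewrite defS !inE eqxx ?orbT.
- exists (s * r ^+ i) (r ^+ (n %/ 2)); rewrite ?groupM ?groupX //.
    by rewrite defS !inE eqxx ?orbT.
  by rewrite expgD mulgA.
- exists (r ^+ i) (s * r ^+ a1); rewrite ?groupX ?rot_mul_refl //.
  by rewrite defS !inE eqxx.
- exists (r ^+ i) (s * r ^+ a2); rewrite ?groupX ?rot_mul_refl //.
  by rewrite defS !inE eqxx ?orbT.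
- exists (r ^+ i) (s * r ^+ a3); rewrite ?groupX ?rot_mul_refl //.
  by rewrite defS !inE eqxx ?orbT.
Qed.
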